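(* Let $\lambda_1,\dots,\lambda_N$ be eigenvalues of the spectral problem (SP) with corresponding eigenfunctions $W_1,\dots,W_N$, and let $A,B,C$ and $c_{sj}$ be the matrices and coefficients defined in the context. Assume that the control system $\dot z=Az+Bu$ with output $y=Cz$ is observable and that $\lambda_j>0$ for all $j=1,\dots,N$. Let $\gamma_0,\dots,\gamma_r>0$ be arbitrary constants, and let $F$ be the $2N\times(r+1)$ matrix whose even-numbered rows are zero and whose $(2j-1)$-th row is $(f_{j0},f_{j1},\dots,f_{jr})$, where $$f_{js}=\gamma_s\frac{c_{sj}}{\lambda_j\|W_j\|_H^2},\qquad j=1,\dots,N,\ s=0,\dots,r.$$ Then, for any $z(0)\in\mathbb{R}^{2N}$, any $\bar z(0)\in\mathbb{R}^{2N}$ and any $u\in L^\infty[0,\infty)$ (with values in $\mathbb{R}^{k+1}$), the corresponding solutions $z(t)$ and $\bar z(t)$ of $$\dot z(t)=Az(t)+Bu(t),\qquad \dot{\bar z}(t)=(A-FC)\bar z(t)+Bu(t)+Fy(t),\qquad y(t)=Cz(t),$$ satisfy $$\|z(t)-\bar z(t)\|\to0\quad\text{as }t\to+\infty.$$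
   Context: Let $l>0$, $0<l_0<l$, and let $\rho,E,I,m,\varkappa>0$ be constants. The spectral problem (SP) is: find $\lambda$ (an eigenvalue) and a real-valued function $W\not\equiv0$ on $[0,l]$ (an eigenfunction) such that $$\frac{d^4}{dx^4}W(x)=\lambda\frac{\rho}{EI}W(x),\ x\in(0,l)\setminus\{l_0\},\qquad W(0)=W(l)=0,\ W''(0)=W''(l)=0,\ W\in C^2[0,l],$$ $$W'''(l_0-0)-W'''(l_0+0)=\frac{\varkappa-\lambda m}{EI}W(l_0).$$ All eigenvalues are real. Define $\|W\|_H^2=\int_0^l\rho\,W(x)^2\,dx+m\,W(l_0)^2$. Let $N\ge1$, $k,r\ge 0$ be integers, let $\psi_1,\dots,\psi_k$ be given (integrable) actuator shape functions on $[0,l]$ with $\operatorname{supp}\psi_i\cap\{0,l_0,l\}=\emptyset$, and let $l_1,\dots,l_r\in[0,l]$ be the sensor locations. The state is $z=(q_1,p_1,\dots,q_N,p_N)^T\in\mathbb{R}^{2N}$, the control is $u=(u_0,u_1,\dots,u_k)^T\in\mathbb{R}^{k+1}$, and the output is $y\in\mathbb{R}^{r+1}$. The matrix $A=\mathrm{diag}(A_1,\dots,A_N)$ is block diagonal with $A_j=\begin{pmatrix}0&1\\-\lambda_j&0\end{pmatrix}$. The $2N\times(k+1)$ matrix $B$ has zero odd-numbered rows, and its $2j$-th row is $(b_{j0},b_{j1},\dots,b_{jk})$ with $$b_{j0}=\frac{W_j(l_0)}{\|W_j\|_H^2},\qquad b_{ji}=\frac{\int_0^l\psi_i(x)W_j''(x)\,dx}{\|W_j\|_H^2},\quad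 i=1,\dots,k.$$ The $(r+1)\times 2N$ matrix $C$ has rows indexed by $s=0,\dots,r$, with $s$-th row $(c_{s1},0,c_{s2},0,\dots,c_{sN},0)$, where $$c_{0j}=W_j(l_0),\qquad c_{sj}=W_j''(l_s),\quad s=1,\dots,r.$$ Observability is the usual notion for linear time-invariant systems (equivalently, the Kalman observability matrix with blocks $C,CA,\dots,CA^{2N-1}$ has rank $2N$). Solutions are understood in the Carathéodory sense (absolutely continuous, satisfying the equations for almost every $t\ge0$). *)

(* Defs.v *)
From HB Require Import structures.
From mathcomp Require Import all_boot all_order all_algebra.
From mathcomp Require Import all_classical all_reals all_analysis.

Set Implicit Arguments.
Unset Strict Implicit.
Unset Printing Implicit Defensive.

Import Order.TTheory GRing.Theory Num.Theory.
Import numFieldNormedType.Exports.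

Local Open Scope classical_set_scope.
Local Open Scope ring_scope.

Section SpectralProblem.
Context {R : realType}.
Implicit Types (D : set R) (f W : R -> R).

(* The limit of the difference quotient is taken along D, hence it is one-sided
   at the end points of an interval and ignores the values of f outside D. *)
Definition derivable_in D f (x : R) : Prop :=
  cvg ((f y - f x) / (y - x) @[y --> within D x^']).

Definition deriv_in D f (x : R) : R :=
  lim ((f y - f x) / (y - x) @[y --> within D x^']).

Definition deriv2_in D f : R -> R := deriv_in D (deriv_in D f).

Definition C2_in D f : Prop :=
  [/\ forall x, D x -> derivable_in D f x,
      forall x, D x -> derivable_in D (deriv_in D f) x &
      {within D, continuous (deriv2_in D f)}].

(* A function on [0, l] is represented by a function on R whose values outside
   [0, l] are irrelevant.  W''' and W'''' are only needed at interior points,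
   where they are ordinary derivatives of W''. *)
Record sp_eigenpair (l l0 rho E I m kappa lambda : R) W : Prop := SpEigenpair {
  sp_nonzero : exists2 x, x \in `[0, l] & W x != 0 ;
  sp_C2 : C2_in `[0, l] W ;
  sp_ode : forall x, x \in `]0, l[ -> x != l0 ->
    [/\ derivable (deriv2_in `[0, l] W) x 1,
        derivable (derive1 (deriv2_in `[0, l] W)) x 1 &
        derive1 (derive1 (deriv2_in `[0, l] W)) x
          = lambda * (rho / (E * I)) * W x] ;
  sp_bc : W 0 = 0 /\ W l = 0 ;
  sp_bc2 : deriv2_in `[0, l] W 0 = 0 /\ deriv2_in `[0, l] W l = 0 ;
  sp_jump : exists a b : R,
    [/\ derive1 (deriv2_in `[0, l] W) x @[x --> l0^'-] --> a,
        derive1 (deriv2_in `[0, l] W) x @[x --> l0^'+] --> b &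
        a - b = (kappa - lambda * m) / (E * I) * W l0]
}.

Definition normH2 (l l0 rho m : R) W : R :=
  Rintegral lebesgue_measure `[0, l] (fun x => rho * W x ^+ 2) + m * W l0 ^+ 2.

Definition actuator_shape (l l0 : R) (psi : R -> R) : Prop :=
  lebesgue_measure.-integrable `[0, l] (EFin \o psi) /\
  closure [set x | x \in `[0, l] /\ psi x != 0] `&` [set 0; l0; l] = set0.

End SpectralProblem.

Section SystemMatrices.
Context {R : realType}.
Variables (l l0 rho m : R) (N k r : nat).
Variables (lambda : 'I_N -> R) (W : 'I_N -> R -> R).
Variables (psi : 'I_k -> R -> R) (sensor : 'I_r -> R) (gamma : 'I_r.+1 -> R).

(* The state (q_1, p_1, ..., q_N, p_N) has N blocks (q_j, p_j) of size 2, and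
   R^{2N} is rendered as 'cV[R]_(\sum_(j < N) 2), as required by the block
   matrices \mxdiag, \mxcol and \mxrow. *)

Definition sysA : 'M[R]_(\sum_(j < N) 2) :=
  \mxdiag_(j < N) (block_mx 0 1%:M (- lambda j)%:M 0 : 'M[R]_(1 + 1)).

Definition coefb (j : 'I_N) (i : 'I_k.+1) : R :=
  (if unlift ord0 i is Some i'
   then Rintegral lebesgue_measure `[0, l]
          (fun x => psi i' x * deriv2_in `[0, l] (W j) x)
   else W j l0) / normH2 l l0 rho m (W j).

Definition sysB : 'M[R]_(\sum_(j < N) 2, k.+1) :=
  \mxcol_(j < N) (col_mx 0 (\row_i coefb j i) : 'M[R]_(1 + 1, k.+1)).

Definition coefc (s : 'I_r.+1) (j : 'I_N) : R :=
  if unlift ord0 s is Some s' then deriv2_in `[0, l] (W j) (sensor s')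
  else W j l0.

Definition sysC : 'M[R]_(r.+1, \sum_(j < N) 2) :=
  \mxrow_(j < N) (row_mx (\col_s coefc s j) 0 : 'M[R]_(r.+1, 1 + 1)).

Definition coeff (j : 'I_N) (s : 'I_r.+1) : R :=
  gamma s * (coefc s j / (lambda j * normH2 l l0 rho m (W j))).

Definition gainF : 'M[R]_(\sum_(j < N) 2, r.+1) :=
  \mxcol_(j < N) (col_mx (\row_s coeff j s) 0 : 'M[R]_(1 + 1, r.+1)).

End SystemMatrices.

Section LinearSystems.
Context {R : realType}.

Definition abs_continuous_on (a b : R) (f : R -> R) : Prop :=
  forall e : R, 0 < e -> exists2 d : R, 0 < d &
    forall (n : nat) (s t : 'I_n -> R),
      (forall i, a <= s i <= t i /\ t i <= b) ->
      (forall i j, i != j -> t i <= s j \/ t j <= s i) ->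
      \sum_i (t i - s i) < d -> \sum_i `|f (t i) - f (s i)| < e.

(* Solutions of z' = A z + g on [0, +oo[ in the sense of Caratheodory. *)
Definition caratheodory_solution (n : nat) (A : 'M[R]_n) (g z : R -> 'cV[R]_n)
    : Prop :=
  (forall T i, 0 < T -> abs_continuous_on 0 T (fun t => z t i ord0)) /\
  {ae lebesgue_measure, forall t : R, 0 <= t -> forall i,
     is_derive t 1 (fun s : R => z s i ord0) ((A *m z t + g t) i ord0)}.

Definition Linfty_control (p : nat) (u : R -> 'cV[R]_p) : Prop :=
  forall i, (fun t => u t i ord0) \_ `[0, +oo[ \in Lfun lebesgue_measure +oo%E.

(* On some finite horizon [0, T], the input and the output determine the
   initial state. *)
Definition observable (n p q : nat)
    (A : 'M[R]_n) (B : 'M[R]_(n, p)) (C : 'M[R]_(q, n)) : Prop :=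
  exists2 T : R, 0 < T &
    forall (u : R -> 'cV[R]_p) (z1 z2 : R -> 'cV[R]_n), Linfty_control u ->
      caratheodory_solution A (fun t => B *m u t) z1 ->
      caratheodory_solution A (fun t => B *m u t) z2 ->
      (forall t, 0 <= t <= T -> C *m z1 t = C *m z2 t) ->
      z1 0 = z2 0.

Definition euclidean_norm (n : nat) (v : 'cV[R]_n) : R :=
  Num.sqrt (\sum_i v i ord0 ^+ 2).

End LinearSystems.

(* Main.v *)
Require Import Defs.
From HB Require Import structures.
From mathcomp Require Import all_boot all_order all_algebra.
From mathcomp Require Import all_classical all_reals all_analysis.
From mathcomp Require Import measurable_realfun ring lra.
Set Implicit Arguments.
Unset Strict Implicit.
Unset Printing Implicit Defensive.
Import Order.TTheory GRing.Theory Num.Theory.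
Import numFieldNormedType.Exports.
Local Open Scope classical_set_scope.
Local Open Scope ring_scope.

(** The error [e = z - zbar] of the observer satisfies [e' = (A - F C) e], and
    the claim is that this linear system is asymptotically stable.

    In modal coordinates the error consists of oscillators
    [q_j' = p_j - correction_j], [p_j' = - lambda_j q_j], coupled only through
    the output errors [eta_s = sum_j c_sj q_j].  Put [h_j] for the squared norm
    of [W_j].  The gain is chosen so that the energy
    [sum_j h_j (lambda_j q_j^2 + p_j^2)] has the derivative
    [- 2 sum_s gamma_s eta_s^2] ([derive_energy]).  It is positive definite,
    because [lambda_j > 0] and an eigenfunction has a positive norm
    ([normH2_gt0]); hence the error is bounded.

    The conclusion is LaSalle's principle, obtained here by Barbalat's lemma: if
    a function converges and its derivative is Lipschitz, the derivative tends
    to 0.  Applied to the energy it gives [eta_s -> 0] ([eta_cvg0]).  Applied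
    repeatedly to a vanishing combination [sum_j w_j q_j] it shows that
    [sum_j w_j lambda_j q_j] vanishes too, so each output error splits into
    parts belonging to single eigenvalues, each of which vanishes
    ([vanish_eigengroup]).  Observability enters through the Hautus test
    ([observable_hautus]): amplitudes of modes with a common eigenvalue that
    are invisible to all outputs give an explicit invisible oscillation, hence
    are zero.  So the coefficients of these parts span all coordinates, and
    every [q_j], then every [p_j], tends to 0 ([position_cvg0],
    [velocity_cvg0]).

    Barbalat's lemma needs classical derivatives, whereas solutions are only
    absolutely continuous with equations holding almost everywhere.  The gap is
    closed by [ac_is_derive]: an absolutely continuous function whose almost
    everywhere derivative is itself absolutely continuous is differentiable at
    every positive time, which follows from the monotonicity theorem
    [ac_nondecreasing]. *)

(** * Absolutely continuous functions with a nonnegative derivative *)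

Section AbsolutelyContinuous.
Context {R : realType}.
Implicit Types (f g : R -> R) (a b t : R).

(** Cousin's covering argument, phrased for a reflexive and transitive relation
    instead of tagged partitions: the supremum of the points reachable from [a]
    has a neighbourhood that [Q] crosses, so it is reachable and cannot be
    smaller than [b]. *)
Lemma interval_chain a b (Q : R -> R -> Prop) :
  a <= b -> (forall x, Q x x) -> (forall x y z, Q x y -> Q y z -> Q x z) ->
  (forall x, a <= x <= b -> exists2 d, 0 < d &
     forall u v, a <= u <= x -> x <= v <= b -> x - u < d -> v - x < d ->
       Q u v) ->
  Q a b.
Proof.
move=> ab Qxx Qtr Qloc.
pose S := [set x | a <= x <= b /\ Q a x].
have Sa : S a by split; rewrite ?lexx.
have ubS : ubound S b by move=> x [/andP[]].
have hS : has_sup S by split; [exists a | exists b].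
have supS x : S x -> x <= sup S by move=> Sx; apply: ub_le_sup Sx; exists b.
set c := sup S.
have ac : a <= c by exact: supS.
have cb : c <= b by apply: ge_sup ubS; exists a.
have [d d0 Qd] := Qloc c (introT andP (conj ac cb)).
have [u Su cu] := sup_adherent d0 hS; have [/andP[au ub] Qau] := Su.
have uc : u <= c by exact: supS.
have Qav v : c <= v <= b -> v - c < d -> Q a v.
  move=> cvb vcd; apply: (Qtr _ _ _ Qau); apply: Qd => //.
    by rewrite au.
  by rewrite ltrBlDr -ltrBlDl.
have [cltb|bc] := ltP c b; last first.
  by apply: Qav; rewrite ?cb ?lexx// (le_lt_trans _ d0)// subr_le0.
pose v := Num.min b (c + d / 2).
have cv : c < v by rewrite lt_min cltb ltrDl divr_gt0.
have vb : v <= b by rewrite ge_min lexx.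
have vd : v - c < d.
  rewrite ltrBlDl (le_lt_trans (_ : v <= c + d / 2)) ?ge_min ?lexx ?orbT//.
  by rewrite ltrD2l ltr_pdivrMr// ltr_pMr// ltr1n.
have Sv : S v.
  by split; [rewrite (le_trans ac (ltW cv))|apply: Qav; rewrite ?(ltW cv)].
by have := supS _ Sv; rewrite leNgt cv.
Qed.

Lemma is_derive_approx f t d : is_derive t 1 f d ->
  forall e, 0 < e -> exists2 r, 0 < r &
    forall y, `|y - t| < r -> `|f y - f t - d * (y - t)| <= e * `|y - t|.
Proof.
move=> df e e0.
have : h^-1 *: (f (h + t) - f t) @[h --> 0^'] --> d.
  have <- : 'D_1 f t = d by exact: derive_val.
  have : derivable f t 1 by [].
  rewrite /derivable => /cvg_ex [l hl].
  have -> : 'D_1 f t = l by rewrite /derive; apply/cvg_lim.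
  by under eq_fun do rewrite -[X in X + t]mulr1.
move/cvgrPdist_le => /(_ e e0); rewrite near_withinE => -[r /= r0 H].
exists r => // y yr; have [->|yt] := eqVneq y t.
  by rewrite !subrr mulr0 subr0 !normr0 mulr0.
have yt0 : y - t != 0 by rewrite subr_eq0.
have /= := H (y - t); rewrite sub0r normrN => /(_ yr yt0).
rewrite subrK => H1.
have -> : f y - f t - d * (y - t)
   = - (y - t) * (d - (y - t)^-1 * (f y - f t)) by field.
by rewrite normrM normrN mulrC ler_wpM2r.
Qed.

Lemma approx_is_derive f t d :
  (forall e, 0 < e -> exists2 r, 0 < r &
    forall y, `|y - t| < r -> `|f y - f t - d * (y - t)| <= e * `|y - t|) ->
  is_derive t 1 f d.
Proof.
move=> H.
suff cv : h^-1 *: (f (h%:A + t) - f t) @[h --> 0^'] --> d.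
  by apply: DeriveDef; [apply/cvg_ex; exists d | exact/cvg_lim].
apply/cvgrPdist_le => e e0; rewrite near_withinE.
have [r r0 Hr] := H e e0; exists r => // h /=; rewrite sub0r normrN => hr h0.
have := Hr (h + t); rewrite addrK => /(_ hr) {}Hr.
rewrite [_%:A]mulr1.
have -> : d - h^-1 *: (f (h + t) - f t)
  = - h^-1 * (f (h + t) - f t - d * h) by rewrite /GRing.scale/=; field.
by rewrite normrM normrN normrV ?unitfE// mulrC ler_pdivrMr ?normr_gt0.
Qed.


(** Absolute continuity for lists of intervals: the covering argument below
    produces its family one interval at a time, which a list follows more
    easily than functions on ['I_n]. *)
Lemma ac_sum_lt a b f e : abs_continuous_on a b f -> 0 < e ->
  exists2 d, 0 < d & forall L : seq (R * R),
    all (fun p => (a <= p.1 <= p.2) && (p.2 <= b)) L ->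
    pairwise (fun p q => (p.2 <= q.1) || (q.2 <= p.1)) L ->
    \sum_(p <- L) (p.2 - p.1) < d -> \sum_(p <- L) `|f p.2 - f p.1| < e.
Proof.
move=> acf e0; have [d d0 H] := acf e e0; exists d => // L aL pL.
rewrite !(big_nth (0, 0)) !big_mkord => Ld.
apply: (H (size L) (fun i => (nth (0, 0) L i).1)) => //.
  by move=> i; have /allP/(_ _ (mem_nth (0, 0) (ltn_ord i)))/andP[] := aL.
move=> i j ij; apply/orP.
have /(pairwiseP (0, 0)) hL := pL.
have [lij|lji|/val_inj eij] := ltngtP i j; last by rewrite eij eqxx in ij.
  by apply: hL; rewrite ?inE.
by rewrite orbC; apply: hL; rewrite ?inE.
Qed.

Lemma ae_lebesgueS (P Q : R -> Prop) : (forall x, P x -> Q x) ->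
  {ae lebesgue_measure, forall x : R, P x} ->
  {ae lebesgue_measure, forall x : R, Q x}.
Proof.
move=> PQ [A [mA A0 PA]]; exists A; split => // x /= nQx.
by apply: PA => /= /PQ.
Qed.

Lemma ae_lebesgueI (P Q : R -> Prop) :
  {ae lebesgue_measure, forall x : R, P x} ->
  {ae lebesgue_measure, forall x : R, Q x} ->
  {ae lebesgue_measure, forall x : R, P x /\ Q x}.
Proof.
move=> [A [mA A0 PA]] [B [mB B0 QB]]; exists (A `|` B); split.
- exact: measurableU.
- exact: etrans (measureU0 mA mB B0) A0.
- by move=> x /= /not_andP[nP|nQ]; [left; exact: PA|right; exact: QB].
Qed.

Lemma ae_open_cover (P : R -> Prop) (d : R) : 0 < d ->
  {ae lebesgue_measure, forall x : R, P x} ->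
  exists U : set R, [/\ open U, forall x, ~ P x -> U x &
    (lebesgue_measure U < d%:E)%E].
Proof.
move=> d0 [A [mA A0 PA]].
have [|U [oU AU UAd]] := lebesgue_regularity_outer mA _ d0.
  by rewrite [ltLHS]A0.
exists U; split=> //; first by move=> x Px; apply/AU/PA.
have mU : measurable U by exact: open_measurable.
apply: le_lt_trans UAd; rewrite -[leLHS]/(lebesgue_measure U) -{1}(setDUK AU).
apply: (le_trans (measureU2 _ _ _)) => //; first exact: measurableD.
by rewrite [X in (X + _)%E]A0 add0e.
Qed.

(** An elementary replacement for the fundamental theorem of calculus of
    absolutely continuous functions.  The exceptional null set lies in an open
    [U] of measure less than [d], where [d] is the modulus of absolute
    continuity for [e].  Walk from [a] to [b] by short steps: at a point where
    the derivative is nonnegative a step loses at most [e] times its length; at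
    an exceptional point the step stays inside [U], and all such steps together
    have length less than [d], hence lose less than [e] in total. *)
Lemma ac_nondecreasing a b f : a <= b -> abs_continuous_on a b f ->
  {ae lebesgue_measure, forall t : R, a <= t <= b ->
     exists2 d, is_derive t 1 f d & 0 <= d} ->
  f a <= f b.
Proof.
move=> ab acf df.
suff key e : 0 < e -> f a - f b <= e * (b - a) + e.
  rewrite -subr_le0; apply/ler_addgt0Pr => e e0; rewrite add0r.
  have c0 : 0 < b - a + 1 by rewrite ltr_wpDl// subr_ge0.
  have /key/le_trans : 0 < e / (b - a + 1) by exact: divr_gt0.
  by apply; rewrite -[X in _ + X]mulr1 -mulrDr divfK// gt_eqF.
move=> e0; have [d d0 Hd] := ac_sum_lt acf e0.
have [U [oU PU Ud]] := ae_open_cover d0 df.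
(* The room that U offers up to x: it bounds the length of the steps taken
   inside U so far, and grows by exactly v - u when ]u, v] lies in U. *)
pose phi x := lebesgue_measure (U `&` `]a, x]%classic).
have mU : measurable U by exact: open_measurable.
have mphi x : measurable (U `&` `]a, x]%classic) by exact: measurableI.
have lemu (A B : set R) : measurable A -> measurable B -> A `<=` B ->
    (lebesgue_measure A <= lebesgue_measure B)%E.
  by move=> mA mB AB; apply: le_measure => //; rewrite inE.
have muU (A B : set R) : measurable A -> measurable B -> A `&` B = set0 ->
    lebesgue_measure (A `|` B) = (lebesgue_measure A + lebesgue_measure B)%E.
  by move=> mA mB AB; rewrite -measureU.
(* L lists the steps taken inside U on the way from a to x. *)
pose Inv x := exists L : seq (R * R), [/\
    all (fun p => (a <= p.1 <= p.2) && (p.2 <= x)) L,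
    pairwise (fun p q => (p.2 <= q.1) || (q.2 <= p.1)) L,
    ((\sum_(p <- L) (p.2 - p.1))%:E <= phi x)%E &
    f a - f x <= e * (x - a) + \sum_(p <- L) `|f p.2 - f p.1|].
have [_ /(_ (lexx a))[]] : a <= b /\ (a <= a -> Inv a -> Inv b).
- pose Q u v := u <= v /\ (a <= u -> Inv u -> Inv v).
  apply: (@interval_chain _ _ Q) => //.
    move=> x y z [xy hxy] [yz hyz]; split; first exact: le_trans yz.
    by move=> ax Ix; apply: hyz; [exact: le_trans xy|exact: hxy].
  (* A step at a regular point leaves L unchanged. *)
  have Qinc u v : u <= v -> - e * (v - u) <= f v - f u -> Q u v.
    move=> uv fuv; split=> // au [L [aL pL sL fL]]; exists L; split => //.
    + by apply: sub_all aL => p /andP[-> /= /le_trans]; apply.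
    + apply: (le_trans sL); apply: lemu => //.
      apply: setIS => x /=; rewrite !in_itv/= => /andP[-> /= /le_trans]; exact.
    + lra.
  (* A step at an exceptional point is added to L. *)
  have QU u v : u <= v -> `]u, v]%classic `<=` U -> Q u v.
    move=> uv uvU; split=> // au [L [aL pL sL fL]].
    exists ((u, v) :: L); split => /=.
    + rewrite au uv lexx/=; apply: sub_all aL => p /andP[-> /= /le_trans].
      exact.
    + rewrite pL andbT; apply: sub_all aL => p /andP[_ ->]; exact: orbT.
    + rewrite big_cons EFinD addeC.
      have -> : (v - u)%:E = lebesgue_measure `]u, v]%classic.
        rewrite lebesgue_measure_itv/= lte_fin; case: ltP => // vu.
        by rewrite (le_anti (introT andP (conj vu uv))) subrr.
      apply: (le_trans (leeD2r _ sL)); rewrite -muU//; last first.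
        rewrite -subset0 => x /= [[_]]; rewrite !in_itv/= => /andP[_ xu].
        by move=> /andP[/(le_lt_trans xu)]; rewrite ltxx.
      apply: lemu => //; first exact: measurableU.
      move=> x /= [[Ux]|xuv].
        rewrite !in_itv/= => /andP[ax xu]; split => //.
        by rewrite ax (le_trans xu).
      split; first exact: uvU.
      move: xuv; rewrite !in_itv/= => /andP[ux ->].
      by rewrite (le_lt_trans au ux).
    + rewrite big_cons/=; have := ler_norm (- (f v - f u)); rewrite normrN.
      have := mulr_ge0 (ltW e0) (_ : 0 <= v - u); rewrite subr_ge0 => /(_ uv).
      nra.
  move=> x axb.
  have [[dx dfx dx0]|nP] := pselect (exists2 d, is_derive x 1 f d & 0 <= d).
    have [r0 r00 Hr] := is_derive_approx dfx e0.
    exists r0 => // u v /andP[au ux] /andP[xv vb] xur vxr; apply: Qinc.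
      exact: le_trans xv.
    have := Hr u; rewrite distrC ger0_norm ?subr_ge0// => /(_ xur).
    have := Hr v; rewrite ger0_norm ?subr_ge0// => /(_ vxr).
    rewrite !ler_norml => /andP[h1 _] /andP[_ h2].
    have h3 : 0 <= dx * (v - x) by rewrite mulr_ge0// subr_ge0.
    have h4 : 0 <= dx * (x - u) by rewrite mulr_ge0// subr_ge0.
    lra.
  have Ux : U x by apply: PU => H; apply: nP; exact: H.
  have [r0 /= r00 rU] : nbhs_ball x U.
    by apply/nbhs_ballP; exact: open_nbhs_nbhs.
  exists r0 => // u v /andP[au ux] /andP[xv vb] xur vxr; apply: QU.
    exact: le_trans xv.
  move=> y /=; rewrite in_itv/= => /andP[uy yv]; apply: rU.
  by rewrite /ball/= ltr_norml; apply/andP; split; lra.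
- exists [::]; split => //=; rewrite big_nil//.
  by rewrite !subrr mulr0 addr0.
- move=> L [aL pL sL fL]; apply: (le_trans fL).
  rewrite lerD2l ltW//; apply: Hd => //.
  rewrite -lte_fin; apply: le_lt_trans Ud; apply: (le_trans sL).
  by apply: lemu => // x [].
Qed.

End AbsolutelyContinuous.

(** * Classical differentiability from almost everywhere equations *)

Section CaratheodoryRegularity.
Context {R : realType}.
Implicit Types (f g : R -> R) (a b t : R).

Lemma ac_subitv a b a' b' f : a <= a' -> b' <= b ->
  abs_continuous_on a b f -> abs_continuous_on a' b' f.
Proof.
move=> aa bb acf e e0; have [d d0 H] := acf e e0; exists d => // n s t hst.
apply: H => i; have [/andP[as_ st] tb] := hst i.
by rewrite (le_trans aa as_) st (le_trans tb bb).
Qed.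

Lemma lipschitz_ac a b f k :
  (forall s t, a <= s -> s <= t -> t <= b -> `|f t - f s| <= k * (t - s)) ->
  abs_continuous_on a b f.
Proof.
move=> fk e e0; have k0 : 0 < `|k| + 1 by rewrite ltr_wpDl.
exists (e / (`|k| + 1)); first exact: divr_gt0.
move=> n s t hst _ sd.
rewrite (@le_lt_trans _ _ ((`|k| + 1) * \sum_i (t i - s i)))//; last first.
  by rewrite mulrC -ltr_pdivlMr.
rewrite mulr_sumr; apply: ler_sum => i _.
have [/andP[as_ st] tb] := hst i; apply: (le_trans (fk _ _ as_ st tb)).
by rewrite ler_wpM2r ?subr_ge0// (le_trans (ler_norm k))// lerDl.
Qed.

Lemma ac_lincomb a b f g x y :
  abs_continuous_on a b f -> abs_continuous_on a b g ->
  abs_continuous_on a b (fun t => x * f t + y * g t).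
Proof.
move=> acf acg e e0.
have k0 : 0 < `|x| + `|y| + 1 by rewrite ltr_wpDl// addr_ge0.
have e1 : 0 < e / (`|x| + `|y| + 1) by exact: divr_gt0.
have [d1 d10 H1] := acf _ e1; have [d2 d20 H2] := acg _ e1.
exists (Num.min d1 d2); first by rewrite lt_min d10.
move=> n s t hst dst; rewrite lt_min => /andP[sd1 sd2].
have {}H1 := H1 n s t hst dst sd1; have {}H2 := H2 n s t hst dst sd2.
have H : \sum_i `|x * f (t i) + y * g (t i) - (x * f (s i) + y * g (s i))|
    <= `|x| * \sum_i `|f (t i) - f (s i)| + `|y| * \sum_i `|g (t i) - g (s i)|.
  rewrite !mulr_sumr -big_split/=; apply: ler_sum => i _.
  rewrite -!normrM (le_trans _ (ler_normD _ _))// le_eqVlt; apply/orP; left.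
  by apply/eqP; congr (`| _ |); ring.
apply: (le_lt_trans H).
have h1 := ler_wpM2l (normr_ge0 x) (ltW H1).
have h2 := ler_wpM2l (normr_ge0 y) (ltW H2).
have : (`|x| + `|y| + 1) * (e / (`|x| + `|y| + 1)) = e.
  by rewrite mulrC divfK// gt_eqF.
move: h1 h2 e1; set E := e / _ => h1 h2 e1 hE; nra.
Qed.

Lemma ac_sum a b n (f : 'I_n -> R -> R) (c : 'I_n -> R) :
  (forall i, abs_continuous_on a b (f i)) ->
  abs_continuous_on a b (fun t => \sum_i c i * f i t).
Proof.
elim: n f c => [|n IH] f c acf.
  apply: (@lipschitz_ac _ _ _ 0) => s t _ _ _.
  by rewrite !big_ord0 subrr normr0 mul0r.
under eq_fun do rewrite big_ord_recl -[X in _ + X]mul1r.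
apply: (@ac_lincomb _ _ (f ord0)
  (fun t => \sum_i c (lift ord0 i) * f (lift ord0 i) t)) => //.
by apply: (IH (fun i => f (lift ord0 i))) => i.
Qed.

Lemma ac_cvg a b f t : abs_continuous_on a b f -> a <= t <= b ->
  forall e, 0 < e -> exists2 d, 0 < d &
    forall y, a <= y <= b -> `|y - t| < d -> `|f y - f t| < e.
Proof.
move=> acf /andP[at_ tb] e e0; have [d d0 H] := acf e e0.
exists d => // y /andP[ay yb] yt.
have H1 u v : a <= u -> u <= v -> v <= b -> v - u < d -> `|f v - f u| < e.
  move=> au uv vb uvd; have := H 1%N (fun=> u) (fun=> v).
  rewrite !big_ord1; apply => //; first by rewrite au uv.
  by move=> i j; rewrite (ord1 i) (ord1 j).
have [ty|/ltW yt'] := leP t y.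
  by apply: H1 => //; rewrite -(ger0_norm (_ : 0 <= y - t)) ?subr_ge0.
rewrite distrC; apply: H1 => //.
by rewrite -(ger0_norm (_ : 0 <= t - y)) ?subr_ge0// distrC.
Qed.

Lemma is_derive_lin f t d c x : is_derive t 1 f d ->
  is_derive t 1 (fun s => c * f s + x * s) (c * d + x).
Proof.
move=> df.
have -> : (fun s => c * f s + x * s) = (c \*: f) + (x \*: @id R) by [].
apply: (is_derive_eq (is_deriveD (is_deriveZ c df)
  (is_deriveZ x (is_derive_id t 1)))).
by congr (_ + _); exact: mulr1.
Qed.

(** Where [g] stays within [e] of [g t], the functions [f s + (e - g t) * s]
    and [(e + g t) * s - f s] have a nonnegative derivative almost everywhere,
    so both are nondecreasing; this squeezes the difference quotients of [f]
    at [t] between [g t - e] and [g t + e]. *)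
Lemma ac_is_derive f g :
  (forall T, 0 < T -> abs_continuous_on 0 T f) ->
  (forall T, 0 < T -> abs_continuous_on 0 T g) ->
  {ae lebesgue_measure, forall t : R, 0 <= t -> is_derive t 1 f (g t)} ->
  forall t, 0 < t -> is_derive t 1 f (g t).
Proof.
move=> acf acg df t t0; apply: approx_is_derive => e e0.
have T0 : 0 < t + 1 by rewrite addr_gt0.
have tT : 0 <= t <= t + 1 by rewrite (ltW t0) lerDl ler01.
have [d d0 Hd] := ac_cvg (acg _ T0) tT e0.
pose r := Num.min d (Num.min t 1).
have r0 : 0 < r by rewrite !lt_min d0 t0 ltr01.
have [rd rt r1] : [/\ r <= d, r <= t & r <= 1] by rewrite !ge_min !lexx !orbT.
have near y : `|y - t| < r -> [/\ 0 <= y, y <= t + 1 & `|g y - g t| < e].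
  move=> yr; have [y0 yT] : 0 <= y /\ y <= t + 1.
    by move: yr; rewrite ltr_norml => /andP[? ?]; split; lra.
  by split=> //; apply: Hd; rewrite ?y0// (lt_le_trans yr).
have mono c x u v : `|u - t| < r -> `|v - t| < r -> u <= v ->
    (forall s, `|g s - g t| < e -> 0 <= c * g s + x) ->
    c * f u + x * u <= c * f v + x * v.
  move=> ur vr uv cx; have [u0 uT _] := near _ ur; have [v0 vT _] := near _ vr.
  apply: (@ac_nondecreasing R u v (fun s => c * f s + x * s)) => //.
    apply: (ac_subitv u0 vT); apply: ac_lincomb; first exact: acf.
    apply: (@lipschitz_ac _ _ _ 1) => s w _ sw _.
    by rewrite mul1r ger0_norm ?subr_ge0.
  apply: ae_lebesgueS df => s ds /andP[us sv].
  have sr : `|s - t| < r.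
    move: ur vr; rewrite !ltr_norml => /andP[? ?] /andP[? ?].
    by apply/andP; split; lra.
  have [s0 _ gs] := near _ sr.
  by exists (c * g s + x); [apply: is_derive_lin; exact: ds | exact: cx].
have slope u v : `|u - t| < r -> `|v - t| < r -> u <= v ->
    `|f v - f u - g t * (v - u)| <= e * (v - u).
  move=> ur vr uv.
  have h1 : 1 * f u + (e - g t) * u <= 1 * f v + (e - g t) * v.
    by apply: mono => // s; rewrite ltr_norml => /andP[? ?]; lra.
  have h2 : (-1) * f u + (e + g t) * u <= (-1) * f v + (e + g t) * v.
    by apply: mono => // s; rewrite ltr_norml => /andP[? ?]; lra.
  by rewrite ler_norml; apply/andP; split; lra.
have tr : `|t - t| < r by rewrite subrr normr0.
exists r => // y yr; have [ty|yt] := leP t y.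
  by have := slope _ _ tr yr ty; rewrite [`|y - t|]ger0_norm// subr_ge0.
have := slope _ _ yr tr (ltW yt); rewrite [`|y - t|]ltr0_norm ?subr_lt0//.
by rewrite opprB -normrN; congr (`| _ | <= _); ring.
Qed.

End CaratheodoryRegularity.

(** * Barbalat's lemma and bounded Lipschitz functions *)

Section Asymptotics.
Context {R : realType}.
Implicit Types (f g : R -> R) (t : R).

Lemma mvt_pos f g (s t : R) : (forall u : R, 0 < u -> is_derive u 1 f (g u)) ->
  0 < s -> s <= t -> exists2 u, s <= u <= t & f t - f s = g u * (t - s).
Proof.
move=> df s0 st.
have cf : {within `[s, t], continuous f}.
  apply: derivable_within_continuous => u; rewrite in_itv/= => /andP[su _].
  by have [] := df u (lt_le_trans s0 su).
have [|u ut E] := @MVT_segment R f g s t st _ cf; last by exists u.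
by move=> u; rewrite in_itv/= => /andP[su _]; apply: df; exact: lt_trans su.
Qed.

(** A Lipschitz [g] that is large at arbitrarily late times stays large over
    an interval of fixed length, and there [f] would move by a fixed amount. *)
Lemma barbalat f g (l : R) :
  (forall t, 0 < t -> is_derive t 1 f (g t)) ->
  (exists k, forall s t, 1 <= s -> s <= t -> `|g t - g s| <= k * (t - s)) ->
  f t @[t --> +oo] --> l -> g t @[t --> +oo] --> 0.
Proof.
move=> df [k gk] /cvgrPdist_le fl; apply/cvgrPdist_le => e e0.
have K0 : 0 < `|k| + 1 by rewrite ltr_wpDl.
(* Over a time h the function g varies by at most e / 2. *)
pose h := e / (2 * (`|k| + 1)).
have h0 : 0 < h by rewrite divr_gt0// mulr_gt0.
have hK : (`|k| + 1) * h = e / 2 by rewrite /h; field; rewrite gt_eqF.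
have eh : 0 < e * h / 4 by rewrite divr_gt0// mulr_gt0.
have [M [Mr HM]] := fl _ eh.
exists (Num.max M 1); split; first exact: num_real.
move=> t; rewrite gt_max => /andP[Mt t1]; rewrite sub0r normrN.
have t0 : 0 < t by rewrite (lt_trans _ t1).
have tth : t <= t + h by rewrite lerDl ltW.
have [u /andP[tu uth] E] := mvt_pos df t0 tth.
have H1 := HM _ Mt; have H2 := HM _ (lt_le_trans Mt tth).
have H3 := gk _ _ (ltW t1) tu.
have H4 : `|g u * h| <= e * h / 2.
  move: E; rewrite addrAC subrr add0r => <-.
  move: H1 H2; rewrite !ler_norml => /andP[? ?] /andP[? ?].
  by apply/andP; split; lra.
have H5 : `|g u| <= e / 2.
  by move: H4; rewrite normrM (gtr0_norm h0) mulrAC ler_pM2r.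
have H6 : k * (u - t) <= e / 2.
  rewrite -hK (le_trans (ler_norm _))// normrM; apply: ler_pM => //.
    by rewrite lerDl.
  by rewrite ger0_norm ?subr_ge0// lerBlDl.
move: H3 H5; rewrite !ler_norml => /andP[? ?] /andP[? ?].
by apply/andP; split; lra.
Qed.

(** The half-line starts at 1 because the differential equations hold with
    two-sided derivatives only at positive times; any positive time would
    do. *)
Definition bounded_lipschitz f : Prop := exists k,
  (forall t, 1 <= t -> `|f t| <= k) /\
  (forall s t, 1 <= s -> s <= t -> `|f t - f s| <= k * (t - s)).

Lemma bounded_lipschitz_ge0 f : bounded_lipschitz f -> exists2 k, 0 <= k &
  (forall t, 1 <= t -> `|f t| <= k) /\
  (forall s t, 1 <= s -> s <= t -> `|f t - f s| <= k * (t - s)).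
Proof.
by move=> [k [H1 H2]]; exists k => //; exact: le_trans (H1 1 (lexx _)).
Qed.

Lemma bounded_lipschitz_derive f g k k' :
  (forall t, 0 < t -> is_derive t 1 f (g t)) ->
  (forall t, 1 <= t -> `|f t| <= k) -> (forall t, 1 <= t -> `|g t| <= k') ->
  bounded_lipschitz f.
Proof.
move=> df fk gk; exists (Num.max k k'); split.
  by move=> t t1; rewrite le_max fk.
move=> s t s1 st.
have [u /andP[su ut] ->] := mvt_pos df (lt_le_trans ltr01 s1) st.
rewrite normrM (ger0_norm (_ : 0 <= t - s)) ?subr_ge0//.
by rewrite ler_wpM2r ?subr_ge0// le_max gk ?orbT// (le_trans s1).
Qed.

Lemma bounded_lipschitz_lincomb f g x y :
  bounded_lipschitz f -> bounded_lipschitz g ->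
  bounded_lipschitz (fun t => x * f t + y * g t).
Proof.
move=> [k [f1 f2]] [k' [g1 g2]]; exists (`|x| * k + `|y| * k'); split.
  move=> t t1; rewrite (le_trans (ler_normD _ _))// !normrM.
  by apply: lerD; apply: ler_wpM2l => //; [exact: f1|exact: g1].
move=> s t s1 st.
have -> : x * f t + y * g t - (x * f s + y * g s)
  = x * (f t - f s) + y * (g t - g s) by ring.
rewrite (le_trans (ler_normD _ _))// !normrM mulrDl -!mulrA.
by apply: lerD; apply: ler_wpM2l => //; [exact: f2|exact: g2].
Qed.

Lemma bounded_lipschitz_sum n (f : 'I_n -> R -> R) (c : 'I_n -> R) :
  (forall i, bounded_lipschitz (f i)) ->
  bounded_lipschitz (fun t => \sum_i c i * f i t).
Proof.
elim: n f c => [|n IH] f c Hf.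
  by exists 0; split => *; rewrite !big_ord0 ?subrr normr0 ?mul0r.
under eq_fun do rewrite big_ord_recl -[X in _ + X]mul1r.
apply: (@bounded_lipschitz_lincomb (f ord0)
  (fun t => \sum_i c (lift ord0 i) * f (lift ord0 i) t)) => //.
by apply: (IH (fun i => f (lift ord0 i))) => i.
Qed.

Lemma bounded_lipschitz_sqr f :
  bounded_lipschitz f -> bounded_lipschitz (fun t => f t ^+ 2).
Proof.
move=> /bounded_lipschitz_ge0[k k0 [f1 f2]].
exists (2 * k * k + k * k); split.
  move=> t t1.
  rewrite normrX expr2 (le_trans (ler_pM _ _ (f1 t t1) (f1 t t1)))//.
  by rewrite lerDr !mulr_ge0.
move=> s t s1 st; rewrite subr_sqr normrM mulrC.
have t1 := le_trans s1 st.
have H : `|f t + f s| <= 2 * k.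
  by rewrite (le_trans (ler_normD _ _))// mulr_natl mulr2n lerD ?f1.
rewrite (le_trans (ler_pM _ _ H (f2 _ _ s1 st)))//.
by rewrite mulrA ler_wpM2r ?subr_ge0// lerDl mulr_ge0.
Qed.

Lemma nonincreasing_cvg f :
  (forall s t, 1 <= s -> s <= t -> f t <= f s) ->
  (forall t, 1 <= t -> 0 <= f t) ->
  exists l : R, f t @[t --> +oo] --> l.
Proof.
move=> fd f0; pose S := [set f t | t in [set t | 1 <= t]].
have hS : has_inf S.
  by split; [exists (f 1), 1 => //=|exists 0 => _ [t /f0 ? <-]].
exists (inf S); apply/cvgrPdist_le => e e0.
have [_ [t0 t01 <-] lt] := inf_adherent e0 hS.
exists t0; split; first exact: num_real.
move=> t t0t; have t1 : 1 <= t by apply: le_trans (ltW t0t).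
have H : inf S <= f t by apply: ge_inf; [case: hS|exists t].
have H' := fd _ _ t01 (ltW t0t).
by rewrite ler_norml; apply/andP; split; lra.
Qed.

Lemma cvg0_sqr_le f g (k : R) : 0 < k ->
  (forall t, 1 <= t -> k * f t ^+ 2 <= `|g t|) ->
  g t @[t --> +oo] --> 0 -> f t @[t --> +oo] --> 0.
Proof.
move=> k0 fg /cvgrPdist_le Hg; apply/cvgrPdist_le => e e0.
have e1 : 0 < k * e ^+ 2 by rewrite mulr_gt0// exprn_gt0.
have [M [Mr HM]] := Hg _ e1.
exists (Num.max M 1); split; first exact: num_real.
move=> t; rewrite gt_max => /andP[/HM + t1]; rewrite !sub0r !normrN => H.
have := le_trans (fg _ (ltW t1)) H; rewrite ler_pM2l//.
by rewrite -real_normK ?num_real// ler_sqr ?nnegrE// ltW.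
Qed.

Lemma eq_cvg0 f g : f =1 g -> f t @[t --> +oo] --> 0 -> g t @[t --> +oo] --> 0.
Proof. by move=> /funext ->. Qed.

Lemma cvg0_lincomb f g x y :
  f t @[t --> +oo] --> 0 -> g t @[t --> +oo] --> 0 ->
  (x * f t + y * g t) @[t --> +oo] --> 0.
Proof.
move=> f0 g0; have -> : (0 : R) = x * 0 + y * 0 by rewrite !mulr0 addr0.
by apply: cvgD; apply: cvgMl_tmp.
Qed.

Lemma cvg0_sum n (f : 'I_n -> R -> R) (c : 'I_n -> R) :
  (forall i, f i t @[t --> +oo] --> 0) ->
  (\sum_i c i * f i t) @[t --> +oo] --> 0.
Proof.
elim: n f c => [|n IH] f c Hf.
  by under eq_fun do rewrite big_ord0; exact: cvg_cst.
under eq_fun do rewrite big_ord_recl -[X in _ + X]mul1r.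
apply: (@cvg0_lincomb (f ord0)
  (fun t => \sum_i c (lift ord0 i) * f (lift ord0 i) t)) => //.
by apply: (IH (fun i => f (lift ord0 i))) => i.
Qed.

End Asymptotics.

(** * Decay of the observation error in modal coordinates *)

(** The estimation error in modal coordinates: [q j] and [p j] are its
    components along mode [j], [eta s] is the error of the [s]-th output, and
    [correction j] is what the observer gain feeds back into mode [j].  The
    hypothesis [c_hautus] says that no motion at a single frequency is
    invisible to all the outputs. *)
Section ModalObserver.
Context {R : realType}.
Implicit Types t : R.
Variables (N r : nat) (lam h : 'I_N -> R) (gam : 'I_r -> R).
Variable c : 'I_r -> 'I_N -> R.
Hypotheses (lam_gt0 : forall j, 0 < lam j) (h_gt0 : forall j, 0 < h j).
Hypothesis gam_gt0 : forall s, 0 < gam s.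
Hypothesis c_hautus : forall (mu : R) (a : 'I_N -> R),
  (forall j, lam j != mu -> a j = 0) ->
  (forall s, \sum_j c s j * a j = 0) -> forall j, a j = 0.
Variables (q p : 'I_N -> R -> R).

Let eta s t := \sum_j c s j * q j t.
Let correction j t := \sum_s gam s * (c s j / (lam j * h j)) * eta s t.

Hypothesis dq : forall t, 0 < t -> forall j,
  is_derive t 1 (q j) (p j t - correction j t).
Hypothesis dp : forall t, 0 < t -> forall j,
  is_derive t 1 (p j) (- lam j * q j t).

Let energy t : R := \sum_j h j * (lam j * q j t ^+ 2 + p j t ^+ 2).
Let dissip t : R := -2 * \sum_s gam s * eta s t ^+ 2.

(** The undamped modes conserve [energy].  The gain carries the factor
    [c s j / (lam j * h j)], which cancels the weight [h j * lam j] of [q j] in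
    the energy, so the outputs reassemble into a sum of squares. *)
Lemma derive_energy t : 0 < t -> is_derive t 1 energy (dissip t).
Proof.
move=> t0.
have -> : energy = \sum_(j < N)
    (h j \*: (lam j \*: (q j ^+ 2) + p j ^+ 2)) :> (R -> R).
  by apply/funext => s; rewrite fct_sumE.
have dj j := is_deriveZ (h j) (is_deriveD
  (is_deriveZ (lam j) (is_deriveX 2 (dq t0 j))) (is_deriveX 2 (dp t0 j))).
apply: (is_derive_eq (is_derive_sum dj)).
pose G j s := gam s * c s j * q j t * eta s t.
transitivity (-2 * \sum_j \sum_s G j s).
  rewrite mulr_sumr; apply: eq_bigr => j _.
  have E : \sum_s G j s = h j * lam j * q j t * correction j t.
    rewrite /correction mulr_sumr; apply: eq_bigr => s _.
    by rewrite /G; field; rewrite !gt_eqF.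
  by rewrite E /GRing.scale/= !expr1; ring.
rewrite exchange_big; congr (_ * _); apply: eq_bigr => s _.
rewrite [in RHS]expr2 [X in _ = _ * (X * _)]/eta mulr_suml mulr_sumr.
apply: eq_bigr => j _; rewrite /G; ring.
Qed.

Let mode_energy_ge0 j t : 0 <= lam j * q j t ^+ 2 + p j t ^+ 2.
Proof. by rewrite addr_ge0 ?sqr_ge0// mulr_ge0 ?sqr_ge0// ltW. Qed.

Lemma energy_ge0 t : 0 <= energy t.
Proof.
apply: sumr_ge0 => j _; by apply: mulr_ge0 => //; exact: ltW.
Qed.

Lemma energy_nonincreasing s t : 1 <= s -> s <= t -> energy t <= energy s.
Proof.
move=> s1 st; rewrite -subr_le0.
have [u _ ->] := mvt_pos derive_energy (lt_le_trans ltr01 s1) st.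
rewrite mulr_le0_ge0 ?subr_ge0//.
rewrite mulr_le0_ge0 ?oppr_le0//.
by apply: sumr_ge0 => i _; rewrite mulr_ge0 ?sqr_ge0// ltW.
Qed.

Lemma modes_bounded : exists k, forall j t, 1 <= t ->
  `|q j t| <= k /\ `|p j t| <= k.
Proof.
pose K := \sum_j (energy 1 / (h j * lam j) + energy 1 / h j).
have Kj j : energy 1 / (h j * lam j) + energy 1 / h j <= K.
  rewrite /K (bigD1 j)//= lerDl; apply: sumr_ge0 => i _.
  by rewrite addr_ge0// divr_ge0 ?energy_ge0 ?mulr_ge0 ?ltW.
exists (K + 1) => j t t1.
have hj := h_gt0 j; have lj := lam_gt0 j.
have Ej : h j * (lam j * q j t ^+ 2 + p j t ^+ 2) <= energy 1.
  rewrite (le_trans _ (energy_nonincreasing (lexx 1) t1))//.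
  rewrite /energy (bigD1 j)//= lerDl; apply: sumr_ge0 => i _.
  by apply: mulr_ge0 => //; exact: ltW.
have E0 : 0 <= energy 1 := energy_ge0 1.
have e1 : 0 <= energy 1 / (h j * lam j) by rewrite divr_ge0// mulr_ge0// ltW.
have e2 : 0 <= energy 1 / h j by rewrite divr_ge0// ltW.
have Q : q j t ^+ 2 <= K.
  apply: le_trans (Kj j); rewrite (@le_trans _ _ (energy 1 / (h j * lam j)))//.
    rewrite ler_pdivlMr ?mulr_gt0// (le_trans _ Ej)//.
    by rewrite mulrDr mulrA [leLHS]mulrC lerDl mulr_ge0 ?sqr_ge0// ltW.
  by rewrite lerDl.
have P : p j t ^+ 2 <= K.
  apply: le_trans (Kj j); rewrite (@le_trans _ _ (energy 1 / h j))//.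
    rewrite ler_pdivlMr// (le_trans _ Ej)//.
    by rewrite mulrC ler_pM2l// lerDr (mulr_ge0 (ltW lj)) ?sqr_ge0.
  by rewrite lerDr.
have K0 : 0 <= K by apply: le_trans Q; exact: sqr_ge0.
have sq x : x ^+ 2 <= K -> `|x| <= K + 1.
  move=> xK; rewrite -ler_sqr ?nnegrE ?addr_ge0// real_normK ?num_real//.
  by nra.
by split; exact: sq.
Qed.

Lemma modes_bounded_lipschitz j :
  bounded_lipschitz (q j) /\ bounded_lipschitz (p j).
Proof.
have [k Hk] := modes_bounded.
have [k0 H0] : exists k0, forall t, 1 <= t -> `|p j t - correction j t| <= k0.
  pose B s := \sum_i `|c s i| * k.
  pose F s := gam s * (c s j / (lam j * h j)).
  exists (k + \sum_s `|F s| * B s) => t t1.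
  rewrite (le_trans (ler_normB _ _))// lerD//; first by have [] := Hk j t t1.
  rewrite (le_trans (ler_norm_sum _ _ _))//; apply: ler_sum => s _.
  rewrite normrM ler_wpM2l// (le_trans (ler_norm_sum _ _ _))//.
  apply: ler_sum => i _; rewrite normrM ler_wpM2l//.
  by have [] := Hk i t t1.
split.
  apply: (@bounded_lipschitz_derive _ _
    (fun t => p j t - correction j t) k k0) => //.
    by move=> t t0; exact: dq.
  by move=> t t1; have [] := Hk j t t1.
apply: (@bounded_lipschitz_derive _ _ (fun t => - lam j * q j t) k (lam j * k)).
- by move=> t t0; exact: dp.
- by move=> t t1; have [] := Hk j t t1.
- move=> t t1; rewrite normrM normrN (gtr0_norm (lam_gt0 j)) ler_pM2l//.
  by have [] := Hk j t t1.
Qed.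

Lemma eta_bounded_lipschitz s : bounded_lipschitz (eta s).
Proof.
by apply: bounded_lipschitz_sum => j; have [] := modes_bounded_lipschitz j.
Qed.

(** The energy decreases to a limit, so its derivative, a negative definite
    quadratic form in the output errors, tends to 0. *)
Lemma eta_cvg0 s : eta s t @[t --> +oo] --> 0.
Proof.
have [l El] := nonincreasing_cvg energy_nonincreasing (fun t _ => energy_ge0 t).
have D0 : dissip t @[t --> +oo] --> 0.
  apply: barbalat derive_energy _ El.
  have : bounded_lipschitz dissip.
    have -> : dissip = fun t => \sum_i (-2 * gam i) * (eta i t ^+ 2).
      apply/funext => t; rewrite /dissip mulr_sumr.
      by apply: eq_bigr => i _; rewrite mulrA.
    apply: bounded_lipschitz_sum => i; apply: bounded_lipschitz_sqr.
    exact: eta_bounded_lipschitz.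
  by move=> [k [_ ?]]; exists k.
apply: (cvg0_sqr_le (gam_gt0 s) _ D0) => t _.
have S0 : gam s * eta s t ^+ 2 <= \sum_i gam i * eta i t ^+ 2.
  rewrite (bigD1 s)//= lerDl; apply: sumr_ge0 => i _.
  by rewrite mulr_ge0 ?sqr_ge0// ltW.
have S1 : 0 <= \sum_i gam i * eta i t ^+ 2.
  by apply: le_trans S0; rewrite mulr_ge0 ?sqr_ge0// ltW.
rewrite (le_trans S0)// normrM (ger0_norm S1) normrN normr_nat.
by rewrite ler_peMl ?ler1n.
Qed.

Lemma correction_cvg0 j : correction j t @[t --> +oo] --> 0.
Proof. by apply: cvg0_sum => s; exact: eta_cvg0. Qed.

(** The linear forms in the positions that tend to 0 along the error;
    [eta_cvg0] puts the rows of [c] among them. *)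
Let vanish (w : 'I_N -> R) := \sum_j w j * q j t @[t --> +oo] --> 0.

Lemma modes_barbalat (w : 'I_N -> R) (f : 'I_N -> R -> R) (g : 'I_N -> R -> R) :
  (forall t, 0 < t -> forall j, is_derive t 1 (f j) (g j t)) ->
  (forall j, bounded_lipschitz (g j)) ->
  \sum_j w j * f j t @[t --> +oo] --> 0 ->
  \sum_j w j * g j t @[t --> +oo] --> 0.
Proof.
move=> df gl; apply: barbalat; last first.
  by have [k [_ Hk]] := bounded_lipschitz_sum w gl; exists k.
move=> t t0.
have -> : (fun t => \sum_j w j * f j t)
    = \sum_(j < N) (w j \*: f j) :> (R -> R).
  by apply/funext => s; rewrite fct_sumE.
exact: (is_derive_sum (fun j => is_deriveZ (w j) (df t t0 j))).
Qed.

(** The correction terms vanish asymptotically, so differentiating a vanishing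
    combination of the positions gives the same combination of the
    velocities. *)
Lemma velocities_cvg0 w : vanish w -> \sum_j w j * p j t @[t --> +oo] --> 0.
Proof.
move=> vw.
have gl j : bounded_lipschitz (fun t => p j t - correction j t).
  have -> : (fun t => p j t - correction j t)
    = (fun t => 1 * p j t + (-1) * correction j t).
    by apply/funext => t; rewrite mul1r mulN1r.
  apply: bounded_lipschitz_lincomb.
    by have [] := modes_bounded_lipschitz j.
  by apply: bounded_lipschitz_sum => s; exact: eta_bounded_lipschitz.
apply: eq_cvg0 (cvg0_lincomb 1 1 (modes_barbalat dq gl vw)
  (cvg0_sum w correction_cvg0)).
move=> t; rewrite !mul1r -big_split/=.
by apply: eq_bigr => j _; rewrite -mulrDr subrK.
Qed.

(** Differentiating once more multiplies the [j]-th coefficient by [- lam j]: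
    the vanishing combinations are stable under the diagonal matrix of the
    eigenvalues, hence under its polynomials. *)
Lemma vanish_shift w nu : vanish w -> vanish (fun j => w j * (lam j - nu)).
Proof.
move=> vw; have gl j : bounded_lipschitz (fun t => - lam j * q j t).
  have -> : (fun t => - lam j * q j t) = (fun t => - lam j * q j t + 0 * q j t).
    by apply/funext => t; rewrite mul0r addr0.
  by apply: bounded_lipschitz_lincomb; have [] := modes_bounded_lipschitz j.
apply: eq_cvg0
  (cvg0_lincomb (-1) (- nu) (modes_barbalat dp gl (velocities_cvg0 vw)) vw).
by move=> t; rewrite !mulr_sumr -big_split; apply: eq_bigr => j _ /=; ring.
Qed.

(** The polynomial whose roots are the eigenvalues other than [mu] is nonzero at
    [mu], so it extracts from a combination the part of frequency [mu]. *)
Lemma vanish_eigengroup w mu :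
  vanish w -> vanish (fun j => w j * (lam j == mu)%:R).
Proof.
move=> vw; pose nus := [seq lam i | i <- enum 'I_N & lam i != mu].
have vs (s : seq R) : vanish (fun j => w j * \prod_(nu <- s) (lam j - nu)).
  elim: s => [|nu s IH].
    by under [X in vanish X]eq_fun do rewrite big_nil mulr1.
  under [X in vanish X]eq_fun do
    rewrite big_cons [_ * \prod_(_ <- _) _]mulrC mulrA.
  exact: vanish_shift.
have kap0 : \prod_(nu <- nus) (mu - nu) != 0.
  rewrite prodf_seq_neq0; apply/allP => nu /mapP[i]; rewrite mem_filter.
  by move=> /andP[imu _] -> /=; rewrite subr_eq0 eq_sym.
apply: eq_cvg0
  (cvg0_lincomb (\prod_(nu <- nus) (mu - nu))^-1 0 (vs nus) (vs nus)) => t.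
rewrite mul0r addr0 mulr_sumr.
apply: eq_bigr => j _; have [->|ljmu] := eqVneq (lam j) mu.
  by rewrite mulr1; field.
have -> : \prod_(nu <- nus) (lam j - nu) = 0; last by rewrite !(mulr0, mul0r).
rewrite (big_rem (lam j))/= ?subrr ?mul0r//.
by rewrite map_f// mem_filter ljmu mem_enum.
Qed.

(** Restricted to the modes of eigenvalue [lam j], the rows of [c] have no
    common kernel vector with a nonzero [j]-th entry, so they span the [j]-th
    coordinate form. *)
Lemma position_cvg0 j : q j t @[t --> +oo] --> 0.
Proof.
pose Cm : 'M[R]_(r, N) := \matrix_(s, i) (c s i * (lam i == lam j)%:R).
have /submxP[D ED] : ((delta_mx 0 j : 'rV[R]_N) <= Cm)%MS.
  rewrite submxE -rowE; apply/eqP/rowP => i; rewrite mxE [RHS]mxE.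
  pose a k := (lam k == lam j)%:R * cokermx Cm k i.
  suff : a j = 0 by rewrite /a eqxx mul1r.
  apply: (c_hautus (mu := lam j)) => [k /negPf kj|s].
    by rewrite /a kj mul0r.
  have := congr1 (fun M : 'M[R]_(r, N) => M s i) (mulmx_coker Cm).
  rewrite mxE [X in _ = X]mxE => E; rewrite -[RHS]E; apply: eq_bigr => k _.
  by rewrite [in RHS]mxE mulrA.
have := cvg0_sum (D ord0) (fun s => vanish_eigengroup (lam j) (eta_cvg0 s)).
apply: eq_cvg0 => t.
transitivity (\sum_i (delta_mx 0 j : 'rV[R]_N) 0 i * q i t).
  rewrite ED; under eq_bigr => s _ do rewrite mulr_sumr.
  rewrite exchange_big/=; apply: eq_bigr => i _.
  by rewrite mxE mulr_suml; apply: eq_bigr => s _; rewrite mxE mulrA.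
rewrite (bigD1 j)//= mxE !eqxx mul1r big1 ?addr0// => i /negPf ij.
by rewrite mxE ij andbF mul0r.
Qed.

Lemma velocity_cvg0 j : p j t @[t --> +oo] --> 0.
Proof.
have vw : vanish (fun i => (i == j)%:R).
  by apply: cvg0_sum => i; exact: position_cvg0.
apply: eq_cvg0 (velocities_cvg0 vw) => t.
by rewrite (bigD1 j)//= eqxx mul1r big1 ?addr0// => i /negPf ->; rewrite mul0r.
Qed.

End ModalObserver.

(** * Positivity of the norm of an eigenfunction *)

Section EigenfunctionNorm.
Context {R : realType}.
Implicit Types (D : set R) (f W : R -> R).

(** The filter [within D x^'] avoids [x], so the continuity at [x] has to be
    recovered from the boundedness of the difference quotient near [x]. *)
Lemma derivable_in_continuous D f :
  (forall x, D x -> derivable_in D f x) -> {within D, continuous f}.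
Proof.
move=> df; apply/subspace_continuousP => x Dx.
have /cvg_ex[/= d Hd] := df x Dx.
have /cvgrPdist_lt/(_ 1 ltr01) := Hd.
rewrite near_withinE near_withinE => -[r /= r0 Hr].
apply/cvgrPdist_le => e e0; rewrite near_withinE.
have K0 : 0 < `|d| + 1 by rewrite ltr_wpDl.
exists (Num.min r (e / (`|d| + 1))) => /=; first by rewrite lt_min r0 divr_gt0.
move=> y /=; rewrite lt_min => /andP[xyr xye] Dy.
have [->|yx] := eqVneq y x; first by rewrite subrr normr0 ltW.
have H := Hr y xyr yx Dy.
have yx0 : y - x != 0 by rewrite subr_eq0.
rewrite distrC -(divfK yx0 (f y - f x)) normrM.
have H1 : `|(f y - f x) / (y - x)| <= `|d| + 1.
  rewrite -lerBlDl ltW// (le_lt_trans _ H)// distrC.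
  exact: le_trans (lerB_dist _ _).
rewrite distrC in xye.
rewrite (le_trans (ler_pM _ _ H1 (ltW xye)))// mulrC divfK// gt_eqF//.
Qed.

Lemma Rintegral_gt0 (a b x0 : R) f :
  {within `[a, b], continuous f} -> (forall x, 0 <= f x) ->
  a < x0 -> x0 < b -> 0 < f x0 ->
  0 < Rintegral lebesgue_measure `[a, b] f.
Proof.
move=> cf f0 ax xb fx0.
have fint : lebesgue_measure.-integrable `[a, b] (EFin \o f).
  by apply: continuous_compact_integrable => //; exact: segment_compact.
have Dx0 : `[a, b]%classic x0 by rewrite /= in_itv/= !ltW.
have /subspace_continuousP/(_ _ Dx0)/cvgrPdist_le/(_ (f x0 / 2)) := cf.
rewrite divr_gt0// near_withinE => /(_ isT)[r /= r0 Hr].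
have rr : r / 2 < r by rewrite ltr_pdivrMr// ltr_pMr// ltr1n.
pose d := Num.min (r / 2) (Num.min (x0 - a) (b - x0)).
have d0 : 0 < d by rewrite !lt_min divr_gt0// !subr_gt0 ax.
have [dr da db] : [/\ d <= r / 2, d <= x0 - a & d <= b - x0].
  by rewrite !ge_min !lexx !orbT.
have JD : `[x0 - d, x0 + d]%classic `<=` `[a, b]%classic.
  by move=> x /=; rewrite !in_itv/= => /andP[? ?]; apply/andP; split; lra.
have fJ x : `[x0 - d, x0 + d]%classic x -> f x0 / 2 <= f x.
  move=> Jx; have := Hr x _ (JD _ Jx) => /=.
  move: Jx; rewrite /= in_itv/= => /andP[x1 x2].
  have -> : (`|x0 - x| < r) = true.
    by rewrite ltr_norml; apply/andP; split; lra.
  move=> /(_ isT) H; have {H} : `|f x0 - f x| <= f x0 / 2 by exact: H.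
  by rewrite ler_norml => /andP[_ ?]; lra.
have fintJ : lebesgue_measure.-integrable `[x0 - d, x0 + d] (EFin \o f).
  exact: integrableS fint.
have cint : lebesgue_measure.-integrable `[x0 - d, x0 + d]
    (EFin \o cst (f x0 / 2)).
  apply: continuous_compact_integrable; first exact: segment_compact.
  by apply: continuous_subspaceT => x; exact: cvg_cst.
apply: (@lt_le_trans _ _ (Rintegral lebesgue_measure `[x0 - d, x0 + d] f)).
  apply: (lt_le_trans _ (le_Rintegral _ cint fintJ fJ)) => //.
  rewrite Rintegral_cst//= lebesgue_measure_itv/= lte_fin.
  rewrite ltrD2l gtrN// /= mulr_gt0 ?divr_gt0//; lra.
apply: fine_le; [exact: integrable_fin_num|exact: integrable_fin_num|].
apply: ge0_subset_integral => //.
  exact: (measurable_int lebesgue_measure).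
by move=> x _; rewrite lee_fin.
Qed.

(** The boundary conditions force a point where [W] does not vanish to be
    interior, where [Rintegral_gt0] applies. *)
Lemma normH2_gt0 (l l0 rho m : R) W : 0 < rho -> 0 <= m ->
  {within `[0, l], continuous W} -> W 0 = 0 -> W l = 0 ->
  (exists2 x, x \in `[0, l] & W x != 0) ->
  0 < normH2 l l0 rho m W.
Proof.
move=> rho0 m0 cW W0 Wl [x]; rewrite in_itv/= => /andP[x0 xl] Wx.
rewrite ltr_pwDl//; last by apply: mulr_ge0 => //; exact: sqr_ge0.
apply: (@Rintegral_gt0 _ _ x).
- have -> : (fun x => rho * W x ^+ 2) = (fun x => rho * (W x * W x)).
    by apply/funext => y; rewrite expr2.
  move=> y; apply: cvgMl_tmp; apply: cvgM; exact: cW.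
- by move=> y; rewrite mulr_ge0 ?sqr_ge0// ltW.
- rewrite lt_neqAle x0 andbT; apply: contraNneq Wx => <-; exact/eqP.
- rewrite lt_neqAle xl andbT; apply: contraNneq Wx => ->; exact/eqP.
- by rewrite mulr_gt0// lt_neqAle sqr_ge0 andbT eq_sym sqrf_eq0.
Qed.

End EigenfunctionNorm.

(** * The system matrices in modal coordinates *)

Section ModalCoordinates.
Context {R : realType} {N : nat}.
Implicit Types (v : 'cV[R]_(\sum_(j < N) 2)) (j : 'I_N).

Definition position j v : R :=
  v (@tagnat.Rank N (fun=> 2) j (lshift 1 ord0 : 'I_(1 + 1))) ord0.

Definition velocity j v : R :=
  v (@tagnat.Rank N (fun=> 2) j (rshift 1 ord0 : 'I_(1 + 1))) ord0.

(** Every entry of the state is a position or a velocity; the witness does not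
    depend on the vector, so that the statement applies to a moving state. *)
Lemma modal_coord_cases (i : 'I_(\sum_(j < N) 2)) :
  (exists j, forall v, v i ord0 = position j v) \/
  (exists j, forall v, v i ord0 = velocity j v).
Proof.
rewrite -(tagnat.sig2K i); move: (tagnat.sig1 i) (tagnat.sig2 i) => j k.
rewrite /position /velocity.
case: (splitP (k : 'I_(1 + 1))) => k' Ek; [left|right]; exists j => v.
  have -> // : k = (lshift 1 ord0 : 'I_(1 + 1)).
  by apply: val_inj; rewrite /= Ek (ord1 k').
have -> // : k = (rshift 1 ord0 : 'I_(1 + 1)).
by apply: val_inj; rewrite /= Ek (ord1 k').
Qed.

Lemma submxcol_modal v j : submxcol v j
  = col_mx (position j v)%:M (velocity j v)%:M :> 'M[R]_(1 + 1, 1).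
Proof.
apply/matrixP => i k; rewrite (ord1 k) !mxE.
case: splitP => i' Ei; rewrite (ord1 i') !mxE eqxx mulr1n.
  have -> // : i = (lshift 1 ord0 : 'I_(1 + 1)).
  by apply: val_inj; rewrite /= Ei (ord1 i').
have -> // : i = (rshift 1 ord0 : 'I_(1 + 1)).
by apply: val_inj; rewrite /= Ei (ord1 i').
Qed.

Let modal_mxcol (a b : 'I_N -> R) j
  (v := \mxcol_j (col_mx (a j)%:M (b j)%:M : 'M[R]_(1 + 1, 1))) :
  position j v = a j /\ velocity j v = b j.
Proof.
have := mxcolK (fun j => col_mx (a j)%:M (b j)%:M : 'M[R]_(1 + 1, 1)) j.
rewrite submxcol_modal => /eq_col_mx[].
move=> /matrixP/(_ ord0 ord0) + /matrixP/(_ ord0 ord0).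
by rewrite !mxE !eqxx !mulr1n.
Qed.

Lemma position_mxcol (a b : 'I_N -> R) j : position j
  (\mxcol_j (col_mx (a j)%:M (b j)%:M : 'M[R]_(1 + 1, 1))) = a j.
Proof. exact: (modal_mxcol a b j).1. Qed.

Lemma velocity_mxcol (a b : 'I_N -> R) j : velocity j
  (\mxcol_j (col_mx (a j)%:M (b j)%:M : 'M[R]_(1 + 1, 1))) = b j.
Proof. exact: (modal_mxcol a b j).2. Qed.

Section SystemCoordinates.
Variables (l l0 rho m : R) (r : nat) (lambda : 'I_N -> R) (W : 'I_N -> R -> R).
Variables (sensor : 'I_r -> R) (gamma : 'I_r.+1 -> R).

Let mxcol_modal v :
  v = \mxcol_j (col_mx (position j v)%:M (velocity j v)%:M : 'M[R]_(1 + 1, 1)).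
Proof.
by rewrite -{1}(submxcolK v); apply: eq_mxcol => j; rewrite submxcol_modal.
Qed.

Let sysAE v : sysA lambda *m v = \mxcol_j
  (col_mx (velocity j v)%:M (- lambda j * position j v)%:M : 'M[R]_(1 + 1, 1)).
Proof.
rewrite {1}(mxcol_modal v) /sysA mul_mxdiag_mxcol; apply: eq_mxcol => j.
have E := mul_block_col (0 : 'M[R]_1) 1%:M (- lambda j)%:M 0
  (position j v)%:M (velocity j v)%:M.
by apply: (etrans E); rewrite !mul0mx add0r mul1mx addr0 -scalar_mxM.
Qed.

Lemma position_sysA v j : position j (sysA lambda *m v) = velocity j v.
Proof. by rewrite sysAE position_mxcol. Qed.

Lemma velocity_sysA v j :
  velocity j (sysA lambda *m v) = - lambda j * position j v.
Proof. by rewrite sysAE velocity_mxcol. Qed.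

Lemma sysCE v s :
  (sysC l l0 W sensor *m v) s ord0
  = \sum_j coefc l l0 W sensor s j * position j v.
Proof.
rewrite {1}(mxcol_modal v) /sysC mul_mxrow_mxcol summxE.
apply: eq_bigr => j _.
have E := mul_row_col (\col_s' coefc l l0 W sensor s' j : 'M[R]_(r.+1, 1)) 0
  (position j v)%:M (velocity j v)%:M.
apply: (etrans (congr1 (fun M : 'M[R]_(r.+1, 1) => M s ord0) E)).
by rewrite mul0mx addr0 mul_mx_scalar !mxE mulrC.
Qed.

Let gainFE (w : 'cV[R]_r.+1) :
  gainF l l0 rho m lambda W sensor gamma *m w = \mxcol_j
  (col_mx (\sum_s coeff l l0 rho m lambda W sensor gamma j s * w s ord0)%:M
     0%:M : 'M[R]_(1 + 1, 1)).
Proof.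
rewrite /gainF mxcol_mul; apply: eq_mxcol => j.
have E := mul_col_mx (\row_s coeff l l0 rho m lambda W sensor gamma j s)
  (0 : 'M[R]_(1, _)) w.
apply: (etrans E); rewrite mul0mx; congr col_mx.
  apply/matrixP => i k; rewrite !ord1 !mxE eqxx mulr1n.
  by apply: eq_bigr => s _; rewrite mxE.
by rewrite raddf0.
Qed.

Lemma position_gainF (w : 'cV[R]_r.+1) j :
  position j (gainF l l0 rho m lambda W sensor gamma *m w)
  = \sum_s coeff l l0 rho m lambda W sensor gamma j s * w s ord0.
Proof. by rewrite gainFE position_mxcol. Qed.

Lemma velocity_gainF (w : 'cV[R]_r.+1) j :
  velocity j (gainF l l0 rho m lambda W sensor gamma *m w) = 0.
Proof. by rewrite gainFE velocity_mxcol. Qed.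

End SystemCoordinates.
End ModalCoordinates.

(** * Linear Caratheodory equations and consequences of observability *)

Section LinearCaratheodory.
Context {R : realType}.

(** The right-hand side of an autonomous linear equation is as regular as the
    solution, so an almost everywhere solution is a classical one. *)
Lemma caratheodory_is_derive n (M : 'M[R]_n) (e : R -> 'cV[R]_n) :
  caratheodory_solution M (fun=> 0) e ->
  forall (t : R) i, 0 < t ->
  is_derive t 1 (fun s : R => e s i ord0) ((M *m e t) i ord0).
Proof.
move=> [ace de] t i; move: t.
apply: (@ac_is_derive _ _ (fun t => (M *m e t) i ord0)) => [T T0|T T0|].
- exact: ace.
- under eq_fun do rewrite mxE.
  by apply: (@ac_sum _ _ _ _ (fun k s => e s k ord0)) => k; exact: ace.
- by apply: ae_lebesgueS de => t /[apply] /(_ i); rewrite addr0.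
Qed.

Lemma observer_error n p (A : 'M[R]_n) (C : 'M[R]_(p, n)) (F : 'M[R]_(n, p))
    (g z zbar : R -> 'cV[R]_n) (y : R -> 'cV[R]_p) :
  caratheodory_solution A g z ->
  (forall t, 0 <= t -> y t = C *m z t) ->
  caratheodory_solution (A - F *m C) (fun t => g t + F *m y t) zbar ->
  caratheodory_solution (A - F *m C) (fun=> 0) (fun t => z t - zbar t).
Proof.
move=> [acz dz] yE [aczb dzb]; split.
  move=> T i T0; have := ac_lincomb 1 (-1) (acz T i T0) (aczb T i T0).
  by congr abs_continuous_on; apply/funext => t; rewrite !mxE mul1r mulN1r.
apply: ae_lebesgueS (ae_lebesgueI dz dzb) => t [dzt dzbt] t0 i.
have -> : (fun s => (z s - zbar s) i ord0)
  = (fun s => z s i ord0) - (fun s => zbar s i ord0).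
  by apply/funext => s; rewrite !mxE.
apply: (is_derive_eq (is_deriveB (dzt t0 i) (dzbt t0 i))).
rewrite yE// -[X in X - _ = _]/((A *m z t + g t) i ord0).
have -> : (A - F *m C) *m (z t - zbar t) + 0 =
  (A *m z t + g t) - ((A - F *m C) *m zbar t + (g t + F *m (C *m z t))).
  rewrite addr0 mulmxBr {1}mulmxBl mulmxA.
  move: (A *m z t) (F *m C *m z t) (_ *m zbar t) => a b c.
  by apply/matrixP => i' j'; rewrite !mxE; ring.
by rewrite [RHS]mxE [in RHS](mxE _ (- _)).
Qed.

Lemma bounded_derive_ac (f g : R -> R) (k : R) a b :
  (forall t : R, is_derive t 1 f (g t)) -> (forall t, `|g t| <= k) ->
  abs_continuous_on a b f.
Proof.
move=> df gk; apply: (@lipschitz_ac _ _ _ _ k) => s t _ st _.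
have cf : {within `[s, t], continuous f}.
  by apply: derivable_within_continuous => u _; have [] := df u.
have [u _ ->] := MVT_segment st (fun u _ => df u) cf.
by rewrite normrM (ger0_norm (_ : 0 <= t - s)) ?subr_ge0// ler_wpM2r ?subr_ge0.
Qed.

(** The real form of a pair of conjugate eigenvectors of [A] for the
    eigenvalues [w] and [- w] times the imaginary unit. *)
Lemma harmonic_solution n (A : 'M[R]_n) (P Q : 'cV[R]_n) (w : R) :
  A *m P = w *: Q -> A *m Q = - w *: P ->
  caratheodory_solution A (fun=> 0)
    (fun t => cos (w * t) *: P + sin (w * t) *: Q).
Proof.
move=> AP AQ.
pose z t := cos (w * t) *: P + sin (w * t) *: Q.
have dz (t : R) i : is_derive t 1 (fun s : R => z s i ord0) ((A *m z t) i ord0).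
  have dwt : is_derive t 1 (fun s : R => w * s) w.
    have := is_deriveZ w (is_derive_id t (1 : R)).
    by move=> /is_derive_eq; apply; exact: mulr1.
  have dc := is_derive1_comp (is_derive_cos (w * t)) dwt.
  have ds := is_derive1_comp (is_derive_sin (w * t)) dwt.
  have -> : (fun s : R => z s i ord0)
    = P i ord0 \*: (cos \o (fun s => w * s))
      + Q i ord0 \*: (sin \o (fun s => w * s)).
    by apply/funext => s; rewrite !mxE /= mulrC [X in _ + X]mulrC.
  apply: (is_derive_eq (is_deriveD (is_deriveZ _ dc) (is_deriveZ _ ds))).
  rewrite /z mulmxDr -!scalemxAr AP AQ !mxE /GRing.scale/=; ring.
split; last first.
  apply: (ae_lebesgueS (P := fun=> True)) => [t _ _ i|].
    by rewrite addr0; exact: dz.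
  by exists set0; split => //; rewrite ?measure0// => x /=.
move=> T i _.
apply: (@bounded_derive_ac _ (fun t => (A *m z t) i ord0)
   (`|w * Q i ord0| + `|w * P i ord0|)).
move=> t; rewrite /z mulmxDr -!scalemxAr AP AQ !mxE.
rewrite (le_trans (ler_normD _ _))//.
rewrite !normrM normrN; apply: lerD.
  by rewrite ler_piMl ?mulr_ge0// ler_norml cos_geN1 cos_le1.
by rewrite ler_piMl ?mulr_ge0// ler_norml sin_geN1 sin_le1.
Qed.

Lemma zero_control p : Linfty_control (fun=> 0 : 'cV[R]_p).
Proof.
move=> i; have -> : (fun t : R => (0 : 'cV[R]_p) i ord0) \_ `[0, +oo[ = cst 0.
  by apply/funext => t; rewrite patchE mxE; case: ifP.
exact: (Lfun_submod_closed lebesgue_measure (leey (1 : \bar R))).1.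
Qed.

End LinearCaratheodory.

Section Hautus.
Context {R : realType}.
Variables (l l0 : R) (N k r : nat).
Variables (lambda : 'I_N -> R) (W : 'I_N -> R -> R) (sensor : 'I_r -> R).

(** If the vector [a] of amplitudes at the single eigenvalue [mu] is invisible
    to the sensors, then so is the free oscillation that starts from the
    positions [a] at rest: its output is [cos (sqrt mu * t)] times the output
    at time 0, which is zero.  Observability compares it with
    the zero solution under the zero control. *)
Lemma observable_hautus (B : 'M[R]_(_, k)) :
  observable (sysA lambda) B (sysC l l0 W sensor) ->
  (forall j, 0 < lambda j) ->
  forall (mu : R) (a : 'I_N -> R), (forall j, lambda j != mu -> a j = 0) ->
  (forall s, \sum_j coefc l l0 W sensor s j * a j = 0) -> forall j, a j = 0.
Proof.
move=> [T T0 obs] lam0 mu a amu ca j.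
have [ljmu|/amu//] := eqVneq (lambda j) mu.
have mu0 : 0 < mu by rewrite -ljmu.
pose w := Num.sqrt mu.
have w2 : w * w = mu by rewrite -expr2 sqr_sqrtr// ltW.
(* All the modes excited by a share the eigenvalue mu, so they oscillate in
   phase and two constant vectors P and Q describe the motion. *)
have la i : lambda i * a i = mu * a i.
  by have [->//|/amu ->] := eqVneq (lambda i) mu; rewrite !mulr0.
pose P : 'cV[R]_(\sum_(j < N) 2) :=
  \mxcol_j (col_mx (a j)%:M 0%:M : 'M[R]_(1 + 1, 1)).
pose Q : 'cV[R]_(\sum_(j < N) 2) :=
  \mxcol_j (col_mx 0%:M (- w * a j)%:M : 'M[R]_(1 + 1, 1)).
have modalE (u v : 'cV[R]_(\sum_(j < N) 2)) :
  (forall i, position i u = position i v) ->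
  (forall i, velocity i u = velocity i v) -> u = v.
  move=> hp hv; rewrite -(submxcolK u) -(submxcolK v); apply: eq_mxcol => i.
  by rewrite !submxcol_modal hp hv.
have posZ c u i : position i (c *: u) = c * position i u.
  by rewrite /position mxE.
have velZ c u i : velocity i (c *: u) = c * velocity i u.
  by rewrite /velocity mxE.
have AP : sysA lambda *m P = w *: Q.
  apply: modalE => i; rewrite ?position_sysA ?velocity_sysA ?posZ ?velZ.
    by rewrite velocity_mxcol position_mxcol mulr0.
  by rewrite velocity_mxcol position_mxcol mulNr la mulNr mulrN mulrA w2.
have AQ : sysA lambda *m Q = - w *: P.
  apply: modalE => i; rewrite ?position_sysA ?velocity_sysA ?posZ ?velZ.
    by rewrite velocity_mxcol position_mxcol.
  by rewrite velocity_mxcol position_mxcol !mulr0.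
have CP : sysC l l0 W sensor *m P = 0.
  apply/colP => s; rewrite sysCE [RHS]mxE -[RHS](ca s).
  by apply: eq_bigr => i _; rewrite position_mxcol.
have CQ : sysC l l0 W sensor *m Q = 0.
  apply/colP => s; rewrite sysCE [RHS]mxE big1// => i _.
  by rewrite position_mxcol mulr0.
have sol0 : caratheodory_solution (sysA lambda) (fun t => B *m 0) (fun=> 0).
  have := @harmonic_solution R _ (sysA lambda) 0 0 0.
  rewrite !mulmx0 !scaler0 => /(_ erefl erefl).
  by congr caratheodory_solution; apply/funext => t;
    rewrite ?mulmx0// !scaler0 addr0.
have solz : caratheodory_solution (sysA lambda) (fun t => B *m 0)
    (fun t => cos (w * t) *: P + sin (w * t) *: Q).
  rewrite mulmx0; exact: harmonic_solution.
have := obs _ _ _ (@zero_control R k) solz sol0 => /(_ _)/(congr1 (position j)).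
rewrite mulr0 cos0 sin0 scale1r scale0r addr0 position_mxcol.
rewrite /position mxE; apply.
by move=> t _; rewrite mulmxDr -!scalemxAr CP CQ !scaler0 addr0 mulmx0.
Qed.

End Hautus.

(** * Convergence of the observer *)

Lemma euclidean_norm_cvg0 (R : realType) n (v : R -> 'cV[R]_n) :
  (forall i, v t i ord0 @[t --> +oo] --> 0) ->
  euclidean_norm (v t) @[t --> +oo] --> 0.
Proof.
move=> v0; rewrite -(sqrtr0 R).
apply: (continuous_cvg _ (@sqrt_continuous R 0)).
have v20 i : v t i ord0 ^+ 2 @[t --> +oo] --> 0.
  by under eq_fun do rewrite expr2; rewrite -(mulr0 (0 : R)); apply: cvgM.
apply: eq_cvg0 (cvg0_sum (fun=> 1) v20) => t.
by apply: eq_bigr => i _; rewrite mul1r.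
Qed.

Theorem theorem1 (R : realType) (l l0 rho E I m kappa : R)
  (l_gt0 : 0 < l) (l0_gt0 : 0 < l0) (l0_ltl : l0 < l)
  (rho_gt0 : 0 < rho) (E_gt0 : 0 < E) (I_gt0 : 0 < I)
  (m_gt0 : 0 < m) (kappa_gt0 : 0 < kappa)
  (N k r : nat) (N_gt0 : (0 < N)%N)
  (psi : 'I_k -> R -> R) (psiP : forall i, actuator_shape l l0 (psi i))
  (sensor : 'I_r -> R) (sensorP : forall s, sensor s \in `[0, l])
  (lambda : 'I_N -> R) (W : 'I_N -> R -> R)
  (eigenP : forall j, sp_eigenpair l l0 rho E I m kappa (lambda j) (W j))
  (obs : observable (sysA lambda) (sysB l l0 rho m W psi)
           (sysC l l0 W sensor))
  (lambda_gt0 : forall j, 0 < lambda j)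
  (gamma : 'I_r.+1 -> R) (gamma_gt0 : forall s, 0 < gamma s) :
  let A := sysA lambda in
  let B := sysB l l0 rho m W psi in
  let C := sysC l l0 W sensor in
  let F := gainF l l0 rho m lambda W sensor gamma in
  forall (z0 zbar0 : 'cV[R]_(\sum_(j < N) 2)) (u : R -> 'cV[R]_k.+1),
  Linfty_control u ->
  forall (z zbar : R -> 'cV[R]_(\sum_(j < N) 2)) (y : R -> 'cV[R]_r.+1),
  z 0 = z0 -> zbar 0 = zbar0 ->
  caratheodory_solution A (fun t => B *m u t) z ->
  (forall t, 0 <= t -> y t = C *m z t) ->
  caratheodory_solution (A - F *m C) (fun t => B *m u t + F *m y t) zbar ->
  euclidean_norm (z t - zbar t) @[t --> +oo] --> 0.
Proof.
move=> A B C F z0 zbar0 u _ z zbar y _ _ solz yE solzbar.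
pose e t := z t - zbar t.
have sole : caratheodory_solution (A - F *m C) (fun=> 0) e.
  exact: observer_error solz yE solzbar.
have de := caratheodory_is_derive sole.
pose h j := normH2 l l0 rho m (W j).
have h_gt0 j : 0 < h j.
  have [W0 [dW _ _] _ [Wl Wr] _ _] := eigenP j.
  by apply: normH2_gt0 => //; [exact: ltW|exact: derivable_in_continuous].
pose c s j := coefc l l0 W sensor s j.
have hautus := observable_hautus obs lambda_gt0.
have dq (t : R) : 0 < t -> forall j, is_derive t 1 (fun s => position j (e s))
    (velocity j (e t) - \sum_s gamma s * (c s j / (lambda j * h j)) *
       \sum_i c s i * position i (e t)).
  move=> t0 j; apply: (is_derive_eq (de t _ t0)).
  rewrite mulmxBl -mulmxA [LHS]mxE -[X in X + _]/(position j (A *m e t)).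
  rewrite position_sysA; congr (_ + _).
  rewrite mxE -[X in - X]/(position j (F *m (C *m e t))) position_gainF.
  by congr (- _); apply: eq_bigr => s _; rewrite sysCE.
have dp (t : R) : 0 < t -> forall j, is_derive t 1 (fun s => velocity j (e s))
    (- lambda j * position j (e t)).
  move=> t0 j; apply: (is_derive_eq (de t _ t0)).
  rewrite mulmxBl -mulmxA [LHS]mxE -[X in X + _]/(velocity j (A *m e t)).
  rewrite velocity_sysA [X in _ + X]mxE.
  rewrite -[X in _ - X]/(velocity j (F *m (C *m e t))).
  by rewrite velocity_gainF subr0.
apply: (@euclidean_norm_cvg0 R _ e) => i.
have q0 := position_cvg0 lambda_gt0 h_gt0 gamma_gt0 hautus dq dp.
have p0 := velocity_cvg0 lambda_gt0 h_gt0 gamma_gt0 hautus dq dp.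
have [[j Ei]|[j Ei]] := @modal_coord_cases R N i.
  by apply: (eq_cvg0 _ (q0 j)) => t; rewrite Ei.
by apply: (eq_cvg0 _ (p0 j)) => t; rewrite Ei.
Qed.
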